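(* Let $r$ be a nonnegative integer. Let $f_1,\ldots,f_k$ be $\mathcal D^r$ functions on $F^n$ such that $S=\{x\in F^n\;|\;f_i(x)\ge 0\ (i=1,\ldots,k)\}$ is nonempty, and let $g$ be a $\mathcal D^r$ function on $F^n$. (i) If $g\ge 0$ on $S$, there exist $\mathcal D^r$ functions $p,v_0,\ldots,v_k$ on $F^n$ such that $p^{-1}(0)\subseteq g^{-1}(0)$ and $p^2g=v_0^2+\sum_{i=1}^k v_i^2f_i$. (ii) If $g>0$ on $S$, there exist $\mathcal D^r$ functions $v_0,\ldots,v_k$ on $F^n$ such that $g=v_0^2+\sum_{i=1}^k v_i^2f_i$.
   Context: Throughout, $\mathcal F=(F,<,+,\cdot,0,1,\ldots)$ is a definably complete locally o-minimal expansion of an ordered field: locally o-minimal means that for every definable $X\subseteq F$ and every $a\in F$ there is an open interval $I\ni a$ such that $X\cap I$ is a finite union of points and open intervals; definably complete means every definable subset of $F$ has a supremum and an infimum in $F\cup\{\pm\infty\}$. ''Definable'' means definable with parameters. $\mathcal D^r$ means definable and of class $\mathcal C^r$ ($r=0$: continuous). *)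

(* Defs.v *)
From HB Require Import structures.
From mathcomp Require Import all_boot all_order all_algebra.
From mathcomp Require Import all_classical all_reals all_analysis.
Import Order.TTheory GRing.Theory Num.Theory.
Import numFieldNormedType.Exports.
Set Implicit Arguments. Unset Strict Implicit. Unset Printing Implicit Defensive.
Local Open Scope classical_set_scope.
Local Open Scope ring_scope.

(* Points of F^n are row vectors 'rV[R]_n (with the product/max-norm topology). *)
Section Defs.
Variable R : realFieldType.

Definition rinit n (x : 'rV[R]_n.+1) : 'rV[R]_n :=
  \row_(i < n) x 0 (widen_ord (leqnSn n) i).
Definition rtail n (x : 'rV[R]_n.+1) : 'rV[R]_n :=
  \row_(i < n) x 0 (lift ord0 i).
Definition rlast n (x : 'rV[R]_n.+1) : R := x 0 ord_max.

Definition pt1 (t : R) : 'rV[R]_1 := const_mx t.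

(* A structure expanding the ordered field (R,<,+,.,0,1), given (van den Dries
   style) by its families S n of definable subsets of F^n, definability being
   with parameters (all singletons are definable). *)
Definition is_expansion (S : forall n, set (set 'rV[R]_n)) : Prop :=
  [/\ (forall n, S n setT),
      (forall n A, S n A -> S n (~` A)),
      (forall n A B, S n A -> S n B -> S n (A `|` B)),
      (forall n A, S n A -> S n.+1 [set x | A (rinit x)] /\
                            S n.+1 [set x | A (rtail x)]) &
      (forall n (i j : 'I_n), S n [set x | x 0 i = x 0 j])] /\
  (forall n A, S n.+1 A -> S n (@rinit n @` A)) /\
  [/\ S 2 [set x | x 0 0 < x 0 (inord 1)],
      S 3 [set x | x 0 0 + x 0 (inord 1) = x 0 (inord 2)],
      S 3 [set x | x 0 0 * x 0 (inord 1) = x 0 (inord 2)] &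
      (forall a : R, S 1 [set x | x 0 0 = a])].

Definition locally_o_minimal (S : forall n, set (set 'rV[R]_n)) : Prop :=
  forall X, S 1 X -> forall a : R,
    exists l u : R, l < a < u /\
      exists (ps : seq R) (ivs : seq (R * R)), forall t : R,
        (l < t < u /\ X (pt1 t)) <->
        (t \in ps \/ exists2 iv, iv \in ivs & iv.1 < t < iv.2).

(* definable completeness: every definable subset of F has a sup and an inf in
   F u {-oo,+oo}, i.e. nonempty bounded-above (below) ones have a least upper
   (greatest lower) bound in F. *)
Definition definably_complete (S : forall n, set (set 'rV[R]_n)) : Prop :=
  forall X, S 1 X ->
    let X' := [set t : R | X (pt1 t)] in
    X' !=set0 ->
    ((exists b, forall t, X' t -> t <= b) ->
       exists s, (forall t, X' t -> t <= s) /\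
                 (forall b, (forall t, X' t -> t <= b) -> s <= b)) /\
    ((exists b, forall t, X' t -> b <= t) ->
       exists s, (forall t, X' t -> s <= t) /\
                 (forall b, (forall t, X' t -> b <= t) -> b <= s)).

Definition definable_fun (S : forall n, set (set 'rV[R]_n)) n
  (f : 'rV[R]_n -> R) : Prop :=
  S n.+1 [set y | rlast y = f (rinit y)].

Fixpoint Cr n (r : nat) (f : 'rV[R]_n -> R) : Prop :=
  match r with
  | 0 => continuous f
  | r'.+1 => continuous f /\
      forall i : 'I_n, (forall x, derivable f x (delta_mx 0 i)) /\
                       Cr r' (fun x => 'D_(delta_mx 0 i) f x)
  end.

Definition Dr (S : forall n, set (set 'rV[R]_n)) n (r : nat)
  (f : 'rV[R]_n -> R) : Prop := definable_fun S f /\ Cr r f.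

End Defs.

(* Main.v *)
(* Write [s t] for the square root of [max(t, 0)], which exists by definable
   completeness. For odd [N > 2r] the function [s(f)^N] is of class C^r whenever
   [f] is, so a negative part can be smoothed without partitions of unity or a
   Lojasiewicz inequality. With [u_i = s(-f_i)^N] the function
   [H = sum_i s(-f_i)^(2N+2) = - sum_i u_i^2 f_i] is nonnegative and vanishes
   exactly on [S], which reduces everything to the single constraint [-H >= 0].
   (i) Writing [g = s(g)^2 - s(-g)^2], where [s(g) s(-g) = 0], take
   [p = s(g)^N + s(-g)^N s(H)^(N+1)], [v_0 = s(g)^(N+1)] and [v_i = w u_i] with
   [w = s(-g)^(N+1) s(H)^N]; then [p^2 g = v_0^2 - w^2 H].
   (ii) If [g > 0] on [S] then [B = H + s(g)^N] is positive everywhere and equals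
   [H] where [g <= 0], so for [w = (1+g^2)(1+H^2)/B] the function [g + w^2 H] is
   positive and has a C^r square root [v_0]. *)
Require Import Defs.
From HB Require Import structures.
From mathcomp Require Import all_boot all_order all_algebra.
From mathcomp Require Import all_classical all_reals all_analysis.
From mathcomp Require Import zify ring lra.
Import Order.TTheory GRing.Theory Num.Theory.
Import numFieldNormedType.Exports.
Local Open Scope ring_scope.

Section Preliminaries.
Set Implicit Arguments. Unset Strict Implicit. Unset Printing Implicit Defensive.
Local Open Scope classical_set_scope.

(** * Definable sets under projection, cylinders and substitution *)

Section DefinableSets.
Context (R : realFieldType) (S : forall n, set (set 'rV[R]_n)).
Hypothesis HS : is_expansion S.

Lemma definable_setI n (A B : set 'rV[R]_n) : S A -> S B -> S (A `&` B).
Proof.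
have [[_ SC SU _ _] _] := HS => SA SB.
by rewrite -(setCK (A `&` B)) setCI; apply/SC/SU; apply/SC.
Qed.

Lemma definable_forall n m (A : 'I_m -> set 'rV[R]_n) :
  (forall i, S (A i)) -> S [set x | forall i, A i x].
Proof.
move=> SA; have [[ST _ _ _ _] _] := HS.
have Sseq (l : seq 'I_m) : S [set x | forall i, i \in l -> A i x].
  elim: l => [|j l IH].
    by rewrite (_ : mkset _ = setT) //; apply/seteqP; split.
  rewrite (_ : mkset _ = A j `&` [set x | forall i, i \in l -> A i x]).
    exact: definable_setI.
  apply/seteqP; split=> x /=.
    by move=> h; split=> [|i il]; apply: h; rewrite inE ?eqxx ?il ?orbT.
  by move=> [Aj h] i; rewrite inE => /predU1P[->//|/h].
rewrite (_ : mkset _ = [set x | forall i, i \in enum 'I_m -> A i x]) //.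
by apply/seteqP; split=> x /= h i; [move=> _|]; apply: h; rewrite ?mem_enum.
Qed.

(** The projection axiom drops the last coordinate only; it is iterated [m] times. [N] and [f] are
    constrained by equations alone, so that passing between [n + m] and [m + n] needs no casts. *)
Lemma definable_proj m n N (f : 'I_n -> 'I_N) (B : set 'rV[R]_N) :
  N = (m + n)%N -> (forall i, f i = i :> nat) -> S B ->
  S [set x | exists2 z, B z & x = \row_i z 0 (f i)].
Proof.
have [_ [SP _]] := HS.
elim: m N f B => [|m IH] N f B e hf SB.
  move: f hf B SB; rewrite e => f hf B SB.
  have fE i : f i = i by apply: ord_inj; rewrite hf.
  rewrite (_ : mkset _ = B) //; apply/seteqP; split=> x /=.
    move=> [z Bz ->]; rewrite (_ : \row_i _ = z) //.
    by apply/rowP => i; rewrite mxE fE.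
  by move=> Bx; exists x => //; apply/rowP => i; rewrite mxE fE.
move: f hf B SB; rewrite e addSn => f hf B SB.
have := IH _ (widen_ord (leq_addl m n)) _ erefl (fun i => erefl) (SP _ _ SB).
congr (S _); have fE i : widen_ord (leqnSn _) (widen_ord (leq_addl m n) i) = f i.
  by apply: val_inj; rewrite /= hf.
apply/seteqP; split=> x /=.
  move=> [_ [z Bz <-] ->]; exists z => //.
  by apply/rowP => i; rewrite !mxE fE.
move=> [z Bz ->]; exists (rinit z); first by exists z.
by apply/rowP => i; rewrite !mxE fE.
Qed.

(** Dual to projection: the clause on [rtail] is iterated to add [k] free coordinates in front. *)
Lemma definable_cyl k m N (f : 'I_m -> 'I_N) (A : set 'rV[R]_m) :
  N = (k + m)%N -> (forall i, f i = (k + i)%N :> nat) -> S A ->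
  S [set z | A (\row_i z 0 (f i))].
Proof.
have [[_ _ _ Sc _] _] := HS.
elim: k N f => [|k IH] N f e hf SA.
  move: f hf; rewrite e => f hf.
  have fE i : f i = i by apply: ord_inj; rewrite hf.
  have := SA; congr (S _); apply/seteqP.
  have rE (x : 'rV[R]_(0 + m)) : \row_i x 0 (f i) = x.
    by apply/rowP => i; rewrite mxE fE.
  by split=> x /=; rewrite rE.
move: f hf; rewrite e addSn => f hf.
have [_] := Sc _ _ (IH _ (@rshift k m) erefl (fun i => erefl) SA).
congr (S _); have fE i : lift ord0 (rshift k i) = f i.
  by apply: val_inj; rewrite /= hf.
have rE (x : 'rV[R]_(k + m).+1) :
    \row_i rtail x 0 (rshift k i) = \row_i x 0 (f i).
  by apply/rowP => i; rewrite !mxE fE.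
by apply/seteqP; split=> x /=; rewrite rE.
Qed.

(* [x] satisfies [A (F x)] iff some [z = (x, t)] has [t = F x] and [A t]. *)
Lemma definable_graph_preimage m n (F : 'I_m -> 'rV[R]_n -> R) (A : set 'rV[R]_m) :
  (forall i, S [set z : 'rV[R]_(n + m) |
                 z 0 (rshift n i) = F i (\row_j z 0 (lshift m j))]) ->
  S A -> S [set x | A (\row_i F i x)].
Proof.
move=> SF SA.
have SB := definable_setI
  (definable_cyl (f := @rshift n m) erefl (fun i => erefl) SA)
                          (definable_forall SF).
have := definable_proj (f := lshift m) (addnC n m) (fun i => erefl) SB.
congr (S _); apply/seteqP; split=> x /=.
  move=> [z [Az zF] ->]; rewrite (_ : \row_i F i _ = \row_i z 0 (rshift n i)) //.
  by apply/rowP => i; rewrite !mxE zF.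
move=> Ax; exists (row_mx x (\row_i F i x)); last first.
  by apply/rowP => i; rewrite mxE row_mxEl.
have lE : \row_j row_mx x (\row_i F i x) 0 (lshift m j) = x.
  by apply/rowP => i; rewrite mxE row_mxEl.
split=> [|i]; last by rewrite lE row_mxEr mxE.
rewrite (_ : \row_i _ = \row_i F i x) //.
by apply/rowP => i; rewrite mxE row_mxEr.
Qed.

(** Graphs of coordinate functions are diagonals, which the axioms provide. This allows variables to
    be permuted, repeated or omitted. *)
Lemma definable_reindex m n (s : 'I_m -> 'I_n) (A : set 'rV[R]_m) :
  S A -> S [set x | A (\row_j x 0 (s j))].
Proof.
apply: (@definable_graph_preimage m n (fun i x => x 0 (s i))) => i.
have [[_ _ _ _ Sd] _] := HS.
have := Sd _ (rshift n i) (lshift m (s i)); congr (S _).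
by apply/seteqP; split=> z /=; rewrite mxE.
Qed.

Lemma definable_preimage m n (F : 'I_m -> 'rV[R]_n -> R) (A : set 'rV[R]_m) :
  (forall i, definable_fun S (F i)) -> S A -> S [set x | A (\row_i F i x)].
Proof.
move=> SF; apply: definable_graph_preimage => i.
(* The graph of [F i] lives in dimension [n.+1]; [s] keeps its arguments and sends its value
   coordinate to slot [n + i] of dimension [n + m]. *)
pose s (j : 'I_n.+1) := if unlift ord_max j is Some j' then lshift m j'
                        else rshift n i.
have := definable_reindex s (SF i); congr (S _).
have sE z : rinit (\row_j z 0 (s j)) = \row_j z 0 (lshift m j) :> 'rV[R]_n.
  apply/rowP => j; rewrite !mxE /s.
  have -> : widen_ord (leqnSn n) j = lift ord_max j.
    by apply: ord_inj; rewrite lift_max.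
  by rewrite liftK.
by apply/seteqP; split=> z /=; rewrite sE /rlast mxE /s unlift_none.
Qed.

Lemma definable_coord n (i : 'I_n) : definable_fun S (fun x => x 0 i).
Proof.
have [[_ _ _ _ Sd] _] := HS.
have := Sd _ ord_max (widen_ord (leqnSn n) i); congr (S _).
by apply/seteqP; split=> z /=; rewrite mxE.
Qed.

Lemma definable_cst n (a : R) : definable_fun S (fun _ : 'rV[R]_n => a).
Proof.
have [_ [_ [_ _ _ Sa]]] := HS.
have := definable_reindex (fun=> @ord_max n) (Sa a); congr (S _).
by apply/seteqP; split=> z /=; rewrite mxE.
Qed.

(** Makes [f] available on points of a graph, whose last coordinate is a value. The reindexing skips
    coordinate [n], on which [f \o rinit] does not depend. *)
Lemma definable_rinit n (f : 'rV[R]_n -> R) :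
  definable_fun S f -> definable_fun S (f \o @rinit R n).
Proof.
move=> /(definable_reindex
  (fun j => if unlift ord_max j is Some j'
            then widen_ord (leqnSn n.+1) (widen_ord (leqnSn n) j')
            else ord_max)).
congr (S _).
have sE (z : 'rV[R]_n.+2) : rinit (rinit z) =
  rinit (\row_j z 0 (if unlift ord_max j is Some j'
            then widen_ord (leqnSn n.+1) (widen_ord (leqnSn n) j')
            else ord_max)).
  apply/rowP => j; rewrite !mxE.
  have -> : widen_ord (leqnSn n) j = lift ord_max j.
    by apply: ord_inj; rewrite lift_max.
  by rewrite liftK; congr (z 0 _); apply: ord_inj; rewrite /= /bump leqNgt ltn_ord.
by apply/seteqP; split=> z /=; rewrite sE /rlast mxE unlift_none.
Qed.

End DefinableSets.

(** * Definability of the field operations, and existence of square roots *)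

Section DefinableFunctions.
Context (R : realFieldType) (S : forall n, set (set 'rV[R]_n)).
Hypothesis HS : is_expansion S.

(** The graph sought is the preimage of the graph of [op] under [(f \o rinit, g \o rinit, rlast)];
    the third component is the default value of [nth]. *)
Lemma definable_binop (op : R -> R -> R) n (f g : 'rV[R]_n -> R) :
  @S 3 [set x | op (x 0 0) (x 0 (inord 1)) = x 0 (inord 2)] ->
  definable_fun S f -> definable_fun S g ->
  definable_fun S (fun x => op (f x) (g x)).
Proof.
move=> Sop Sf Sg.
pose F (i : 'I_3) : 'rV[R]_n.+1 -> R :=
  nth (@rlast R n) [:: f \o @rinit R n; g \o @rinit R n] i.
have SF i : definable_fun S (F i).
  rewrite /F; case: i => -[|[|[|//]]] ?; try exact: definable_rinit.
  exact: definable_coord.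
have := definable_preimage HS SF Sop; congr (@S _ _).
by apply/seteqP; split=> y /=; rewrite !mxE /F !inordK.
Qed.

Lemma definable_lt n (f g : 'rV[R]_n -> R) :
  definable_fun S f -> definable_fun S g -> S [set x | f x < g x].
Proof.
move=> Sf Sg; have [_ [_ [Slt _ _ _]]] := HS.
pose F (i : 'I_2) := nth g [:: f] i.
have SF i : definable_fun S (F i) by rewrite /F; case: i => -[|[|//]] ?.
have := definable_preimage HS SF Slt; congr (@S _ _).
by apply/seteqP; split=> y /=; rewrite !mxE /F !inordK.
Qed.

Lemma definable_le n (f g : 'rV[R]_n -> R) :
  definable_fun S f -> definable_fun S g -> S [set x | f x <= g x].
Proof.
move=> Sf Sg; have [[_ SC _ _ _] _] := HS.
have := SC _ _ (definable_lt Sg Sf); congr (@S _ _).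
by apply/seteqP; split=> y /=; rewrite leNgt => /negP.
Qed.

Lemma definable_eq n (f g : 'rV[R]_n -> R) :
  definable_fun S f -> definable_fun S g -> S [set x | f x = g x].
Proof.
move=> Sf Sg.
have := definable_setI HS (definable_le Sf Sg) (definable_le Sg Sf).
congr (@S _ _); apply/seteqP; split=> y /=; last by move=> ->.
by move=> [fg gf]; apply/le_anti; rewrite fg gf.
Qed.

Lemma definable_add n (f g : 'rV[R]_n -> R) :
  definable_fun S f -> definable_fun S g -> definable_fun S (fun x => f x + g x).
Proof. by have [_ [_ [_ Sa _ _]]] := HS; apply: definable_binop. Qed.

Lemma definable_mul n (f g : 'rV[R]_n -> R) :
  definable_fun S f -> definable_fun S g -> definable_fun S (fun x => f x * g x).
Proof. by have [_ [_ [_ _ Sm _]]] := HS; apply: definable_binop. Qed.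

(* The junk value [0^-1 = 0] is harmless since it is definable. *)
Lemma definable_inv n (f : 'rV[R]_n -> R) :
  definable_fun S f -> definable_fun S (fun x => (f x)^-1).
Proof.
move=> Sf; pose t : 'rV[R]_n.+1 -> R := @rlast R n.
have St : definable_fun S t by exact: definable_coord.
have Su := definable_rinit HS Sf.
have S1 := definable_eq (definable_mul Su St) (definable_cst HS _ 1).
have S2 := definable_setI HS (definable_eq Su (definable_cst HS _ 0))
                             (definable_eq St (definable_cst HS _ 0)).
have [[_ _ SU _ _] _] := HS; have := SU _ _ _ S1 S2; congr (@S _ _).
apply/seteqP; split=> y /=; rewrite -/(t y).
  move=> [|[-> ->]]; last by rewrite invr0.
  move=> uv; apply: (mulfI (x := f (rinit y))).
    by apply/eqP => u0; move: uv => /eqP; rewrite u0 mul0r eq_sym oner_eq0.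
  rewrite divff //; apply/eqP => u0.
  by move: uv => /eqP; rewrite u0 mul0r eq_sym oner_eq0.
move=> ->; have [u0|u0] := eqVneq (f (rinit y)) 0; last by left; rewrite divff.
by right; rewrite u0 invr0.
Qed.

Definition is_sqrt_pos (s : R -> R) :=
  forall t, 0 <= s t /\ s t ^+ 2 = Num.max t 0.

(** The specification determines [s], so its graph is cut out by the sign and the square of the last
    coordinate. *)
Lemma definable_sqrt s n (f : 'rV[R]_n -> R) : is_sqrt_pos s ->
  definable_fun S f -> definable_fun S (fun x => s (f x)).
Proof.
move=> hs Sf; pose t : 'rV[R]_n.+1 -> R := @rlast R n.
have St : definable_fun S t by exact: definable_coord.
have Su := definable_rinit HS Sf; have S0 := definable_cst HS n.+1 (0 : R).
have Stt := definable_mul St St.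
have S1 := definable_setI HS (definable_lt S0 Su) (definable_eq Stt Su).
have S2 := definable_setI HS (definable_le Su S0) (definable_eq Stt S0).
have [[_ _ SU _ _] _] := HS.
have := definable_setI HS (definable_le S0 St) (SU _ _ _ S1 S2).
congr (@S _ _); apply/seteqP; split=> y /=; rewrite -/(t y).
  have [s0 s2] := hs (f (rinit y)).
  move=> [t0 h]; apply/eqP; rewrite -(@eqrXn2 _ 2) // s2; apply/eqP.
  move: h => [[u0 tt]|[u0 tt]]; first by rewrite max_l // ltW.
  by rewrite max_r.
move=> ->; have [s0 s2] := hs (f (rinit y)); split=> //.
by case: leP s2 => u0 s2; [right|left].
Qed.

(** The root of [c] is the supremum [b] of the definable set [t * t <= c]; both strict inequalities
    between [b * b] and [c] are refuted by moving [b] slightly. *)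
Lemma exists_sqrt_pos : definably_complete S -> exists s, is_sqrt_pos s.
Proof.
move=> Hdc.
suff ex a : exists b : R, 0 <= b /\ b ^+ 2 = Num.max a 0.
  by have [s hs] := choice ex; exists s.
set c := Num.max a 0; have c0 : 0 <= c by rewrite le_max lexx orbT.
pose x0 (x : 'rV[R]_1) := x 0 0.
have Sx : definable_fun S x0 by exact: definable_coord.
have SX := definable_le (definable_mul Sx Sx) (definable_cst HS 1 c).
have [|+ _] := Hdc _ SX; first by exists 0; rewrite /= /x0 !mxE mul0r.
case=> [|b [ub lub]].
  by exists (1 + c) => t; rewrite /= /x0 !mxE => tc; nra.
have {}ub t : t * t <= c -> t <= b by move=> tc; apply: ub; rewrite /= /x0 !mxE.
have {}lub d : (forall t, t * t <= c -> t <= d) -> b <= d.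
  by move=> h; apply: lub => t; rewrite /= /x0 !mxE; exact: h.
have b0 : 0 <= b by apply: ub; rewrite mul0r.
exists b; split=> //; rewrite expr2.
have [bc|bc|//] := ltgtP (b * b) c.
  (* The last term of the denominator ensures [e <= 1], whence [(b + e)^2 <= b^2 + e (2 b + 1) <= c]
     and [b + e] lies in the set. *)
  pose e := (c - b * b) / (2 * b + 1 + (c - b * b)).
  have d0 : 0 < 2 * b + 1 + (c - b * b) by lra.
  have e0 : 0 < e by rewrite divr_gt0 //; lra.
  have e1 : e <= 1 by rewrite ler_pdivrMr //; lra.
  have eE : e * (2 * b + 1 + (c - b * b)) = c - b * b by rewrite mulfVK ?gt_eqF.
  have : b + e <= b by apply: ub; nra.
  lra.
have bp : 0 < b by nra.
(* A Newton step: [(b - e)^2 = c + e^2], so [b - e] is a smaller upper bound. *)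
pose e := (b * b - c) / (2 * b).
have e0 : 0 < e by rewrite divr_gt0 //; lra.
have eE : e * (2 * b) = b * b - c by rewrite mulfVK // gt_eqF //; lra.
have be : 0 <= b - e by nra.
have bc2 : c <= (b - e) ^+ 2.
  by rewrite (_ : _ ^+ 2 = b * b - e * (2 * b) + e ^+ 2); [nra|ring].
have : b <= b - e.
  apply: lub => t tc; rewrite leNgt; apply/negP => et.
  suff : (b - e) ^+ 2 < t * t by lra.
  by rewrite expr2 ltr_pM.
lra.
Qed.
End DefinableFunctions.

(** * Calculus of C^r functions through iterated partial derivatives *)

Section ClassCr.
Context (R : realFieldType).

Lemma is_derive_cvg (V : normedModType R) (f : V -> R) x v l :
  h^-1 *: (f (h *: v + x) - f x) @[h --> 0^'] --> l -> is_derive x v f l.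
Proof. by move=> fl; apply: DeriveDef; [apply: cvgP fl|apply: cvg_lim fl]. Qed.

(** Restriction to the line [h *: v + x] reduces this to the one-variable chain rule, where
    derivability is differentiability; [f] itself is only assumed derivable along [v]. *)
Lemma is_derive_comp_real (V : normedModType R) (f : V -> R) (phi : R -> R) x v a b :
  is_derive (f x) 1 phi a -> is_derive x v f b -> is_derive x v (phi \o f) (a * b).
Proof.
move=> [dphi <-] [df <-]; pose g h := f (h *: v + x).
have g0 : g 0 = f x by rewrite /g scale0r add0r.
have deriveE (u : V -> R) : 'D_v u x = (fun h => u (h *: v + x))^`() 0.
  rewrite derive1E /derive.
  set u1 := fun h => h^-1 *: _; set u2 := fun h => h^-1 *: _.
  suff -> : u1 = u2 by []; apply/funext => h; rewrite /u1 /u2 /=.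
  by rewrite addr0 scale0r add0r [_%:A]mulr1.
have dg : derivable g 0 1 by exact: (iffLR (derivable1P f x v) df).
have dphi' : derivable phi (g 0) 1 by rewrite g0.
apply: DeriveDef.
  apply: (iffRL (derivable1P _ _ _)); apply/(derivable1_diffP (phi \o g)).
  move: dg dphi' => /derivable1_diffP dg /derivable1_diffP dphi'.
  exact: (differentiable_comp dg dphi').
rewrite !deriveE -(derive1E phi) -g0.
exact: (derive1_comp dg dphi').
Qed.

Lemma Cr_continuous n r (f : 'rV[R]_n -> R) : Cr r f -> continuous f.
Proof. by case: r => [//|r []]. Qed.

Lemma Cr_pred n r (f : 'rV[R]_n -> R) : Cr r.+1 f -> Cr r f.
Proof.
elim: r f => [f []//|r IH f [cf df]]; split=> // i; have [dfi Cdfi] := df i.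
by split=> //; apply: IH.
Qed.

Lemma CrSI n r (f : 'rV[R]_n -> R) (df : 'I_n -> 'rV[R]_n -> R) :
  continuous f -> (forall i x, is_derive x (delta_mx 0 i) f (df i x)) ->
  (forall i, Cr r (df i)) -> Cr r.+1 f.
Proof.
move=> cf hdf Cdf; split=> // i; split=> [x|]; first by case: (hdf i x).
rewrite (_ : (fun x => _) = df i) //; apply/funext => x.
by case: (hdf i x).
Qed.

Lemma Cr_is_derive n r (f : 'rV[R]_n -> R) i x : Cr r.+1 f ->
  is_derive x (delta_mx 0 i) f ('D_(delta_mx 0 i) f x).
Proof. by case=> _ /(_ i)[d _]; apply: derivableP. Qed.

Lemma Cr_derive n r (f : 'rV[R]_n -> R) i : Cr r.+1 f ->
  Cr r (fun x => 'D_(delta_mx 0 i) f x).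
Proof. by case=> _ /(_ i)[_]. Qed.

Lemma Cr_cst n r (a : R) : Cr r (fun _ : 'rV[R]_n => a).
Proof.
elim: r a => [|r IH] a; first exact: cst_continuous.
apply: (@CrSI _ _ _ (fun _ _ => 0)) => //; exact: cst_continuous.
Qed.

Lemma Cr_add n r (f g : 'rV[R]_n -> R) :
  Cr r f -> Cr r g -> Cr r (fun x => f x + g x).
Proof.
elim: r f g => [|r IH] f g Cf Cg.
  by move=> x; apply: continuousD; [exact: Cf|exact: Cg].
apply: (@CrSI _ _ _ (fun i x => 'D_(delta_mx 0 i) f x + 'D_(delta_mx 0 i) g x)).
- move=> x; apply: continuousD; first exact: (Cr_continuous Cf).
  exact: (Cr_continuous Cg).
- move=> i x; apply: is_deriveD; first exact: (Cr_is_derive i x Cf).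
  exact: (Cr_is_derive i x Cg).
- by move=> i; apply: IH; apply: Cr_derive.
Qed.

Lemma Cr_mul n r (f g : 'rV[R]_n -> R) :
  Cr r f -> Cr r g -> Cr r (fun x => f x * g x).
Proof.
elim: r f g => [|r IH] f g Cf Cg.
  by move=> x; apply: continuousM; [exact: Cf|exact: Cg].
apply: (@CrSI _ _ _ (fun i x => f x * 'D_(delta_mx 0 i) g x +
                                g x * 'D_(delta_mx 0 i) f x)).
- move=> x; apply: continuousM; first exact: (Cr_continuous Cf).
  exact: (Cr_continuous Cg).
- move=> i x; apply: is_deriveM; first exact: (Cr_is_derive i x Cf).
  exact: (Cr_is_derive i x Cg).
- by move=> i; apply: Cr_add; apply: IH; by [apply: Cr_pred|apply: Cr_derive].
Qed.

(** The partial derivatives are polynomial in [(f x)^-1] and those of [f], so induction on [r] works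
    with [f] fixed. *)
Lemma Cr_inv n r (f : 'rV[R]_n -> R) :
  (forall x, f x != 0) -> Cr r f -> Cr r (fun x => (f x)^-1).
Proof.
move=> f0; elim: r => [|r IH] Cf.
  by move=> x; apply: continuousV => //; exact: Cf.
have Cf1 := IH (Cr_pred Cf).
apply: (@CrSI _ _ _ (fun i x => -1 * ((f x)^-1 * (f x)^-1) *
                                'D_(delta_mx 0 i) f x)).
- by move=> x; apply: continuousV => //; apply: (Cr_continuous Cf).
- move=> i x; have [df _] := Cr_is_derive i x Cf.
  apply: DeriveDef; first exact: derivableV.
  by rewrite deriveV // -invfM -expr2 mulN1r.
- move=> i; apply: Cr_mul; last exact: Cr_derive.
  by apply: Cr_mul; [apply: Cr_cst|apply: Cr_mul].
Qed.

End ClassCr.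

(** * Regularity of [s] and of its powers *)

Section Sqrt.
Context (R : realFieldType) (s : R -> R).
Hypothesis hs : is_sqrt_pos s.

Let s_ge0 t : 0 <= s t. Proof. by case: (hs t). Qed.

Lemma sqrt_pos_sqr t : 0 <= t -> s t ^+ 2 = t.
Proof. by move=> t0; case: (hs t) => _ ->; rewrite max_l. Qed.

Lemma sqrt_pos_neg t : t <= 0 -> s t = 0.
Proof.
by move=> t0; case: (hs t) => _; rewrite max_r // => /eqP; rewrite sqrf_eq0 => /eqP.
Qed.

Lemma sqrt_pos_gt0 t : 0 < t -> 0 < s t.
Proof.
move=> t0; rewrite lt_neqAle s_ge0 andbT eq_sym -sqrf_eq0.
by rewrite sqrt_pos_sqr ?gt_eqF // ltW.
Qed.

Lemma sqrt_pos_continuous : continuous s.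
Proof.
(* A Hölder estimate of exponent 1/2: a tolerance [e] on values allows [e ^+ 2] on arguments. *)
have key x y : x <= y -> (s y - s x) ^+ 2 <= y - x.
  move=> xy; have [y0|y0] := leP y 0.
    by rewrite !sqrt_pos_neg ?subr0 ?expr0n ?subr_ge0 //; lra.
  have := sqrt_pos_sqr (ltW y0); have := s_ge0 y; have := s_ge0 x.
  have [x0|x0] := leP x 0; first by rewrite (sqrt_pos_neg x0); nra.
  have := sqrt_pos_sqr (ltW x0); move: (s x) (s y) => a b a2 a0 b0 b2.
  have : a <= b by rewrite -(@ler_pXn2r _ 2) ?nnegrE // a2 b2.
  nra.
have {}key x y : (s x - s y) ^+ 2 <= `|x - y|.
  have [xy|/ltW xy] := leP x y; last by rewrite ger0_norm ?subr_ge0 // key.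
  by rewrite distrC ger0_norm ?subr_ge0 // -sqrrN opprB key.
move=> t; apply/cvgrPdist_lt => e e0; near=> u.
have ute : `|t - u| < e ^+ 2.
  by near: u; apply: cvgr_dist_lt; [exact: cvg_id|rewrite exprn_gt0].
suff : `|s t - s u| ^+ 2 < e ^+ 2 by rewrite ltr_pXn2r ?nnegrE // ltW.
by apply: le_lt_trans ute; rewrite real_normK ?num_real.
Unshelve. all: by end_near. Qed.

Lemma sqrt_pos_exp_continuous j : continuous (fun t => s t ^+ j).
Proof.
elim: j => [|j IH] t; first by apply: cst_continuous.
rewrite (_ : (fun u => _) = s \* (fun u => s u ^+ j)).
  by apply: continuousM; [exact: sqrt_pos_continuous|exact: IH].
by apply/funext => u; rewrite exprS.
Qed.

(* Holds at [t < 0] too, where both sides vanish since [0^-1 = 0]. *)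
Lemma is_derive_sqrt_pos (t : R) : t != 0 -> is_derive t (1 : R) s (2 * s t)^-1.
Proof.
rewrite neq_lt => /orP[t0|t0].
  apply: (@near_eq_is_derive _ _ _ (cst 0)).
    by near=> u; rewrite sqrt_pos_neg //; near: u; exact: lt_le_nbhsl.
  by rewrite sqrt_pos_neg ?ltW // mulr0 invr0; exact: is_derive_cst.
apply: is_derive_cvg.
have st0 := sqrt_pos_gt0 t0.
(* This is the difference quotient after rationalisation. *)
have : (s (h *: 1 + t) + s t)^-1 @[h --> 0^'] --> (2 * s t)^-1.
  rewrite (_ : 2 * s t = s t + s t); last by ring.
  apply: cvgV; first by rewrite gt_eqF ?addr_gt0.
  apply: cvgD; last exact: cvg_cst.
  rewrite (_ : (fun h => _) = s \o shift t).
    by apply/continuous_withinNshiftx; exact: sqrt_pos_continuous.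
  by apply/funext => h /=; rewrite [h *: 1]mulr1.
apply: cvg_trans; apply: near_eq_cvg; near=> h.
have h0 : h != 0 by near: h; exact: nbhs_dnbhs_neq.
have ht0 : 0 < h + t.
  suff : `|h| < t by rewrite ltr_norml => /andP[]; lra.
  by near: h; exact: dnbhs0_lt.
have sht := sqrt_pos_gt0 ht0.
have hE : (s (h + t) - s t) * (s (h + t) + s t) = h.
  by rewrite -subr_sqr !sqrt_pos_sqr ?ltW // addrK.
rewrite [h *: 1]mulr1 /GRing.scale /=; apply: (mulfI h0).
by rewrite mulVKf // -{1}hE mulfK // gt_eqF // addr_gt0.
Unshelve. all: by end_near. Qed.

(** Away from [0] this is the power rule. At [0] the quotient [s h ^+ j.+3 / h] equals
    [s h ^+ j.+1], which tends to [0]. *)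
Lemma is_derive_sqrt_pos_exp (t : R) j :
  is_derive t (1 : R) (fun u => s u ^+ j.+3) (j.+3%:R / 2 * s t ^+ j.+1).
Proof.
have [->|t0] := eqVneq t 0; last first.
  have := is_deriveX j.+3 (is_derive_sqrt_pos t0).
  rewrite exprfctE; congr is_derive; rewrite /GRing.scale /=.
  (* For [t < 0] both sides vanish; [field] needs [s t] nonzero. *)
  have [->|st0] := eqVneq (s t) 0; first by rewrite !expr0n /= !mulr0 mul0r.
  rewrite [s t ^+ j.+2]exprSr; move: (s t ^+ j.+1) (j.+3%:R : R) => a b.
  by field.
apply: is_derive_cvg; rewrite sqrt_pos_neg // !expr0n mulr0.
rewrite (_ : (fun h => _) = fun h : R => s h ^+ j.+1).
  have /continuous_withinNx : {for 0, continuous (fun h : R => s h ^+ j.+1)}.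
    exact: (@sqrt_pos_exp_continuous j.+1 0).
  by rewrite sqrt_pos_neg // expr0n.
apply/funext => h; rewrite [h *: 1]mulr1 addr0 subr0.
change (h^-1 * s h ^+ j.+3 = s h ^+ j.+1).
have [h0|h0] := leP h 0; first by rewrite sqrt_pos_neg // !expr0n /= mulr0.
by rewrite -addn2 exprD sqrt_pos_sqr ?ltW // mulrCA mulVf ?mulr1 // gt_eqF.
Qed.

(** Each differentiation lowers the exponent by 2 and must leave a positive power, whence the bound
    [2 r < j]. *)
Lemma Cr_sqrt_pos_exp n r j (f : 'rV[R]_n -> R) :
  (r.*2 < j)%N -> Cr r f -> Cr r (fun x => s (f x) ^+ j).
Proof.
elim: r j => [|r IH] j rj Cf; have cf := Cr_continuous Cf.
  move=> x; apply: (@continuous_comp _ _ _ f (fun t => s t ^+ j)); first exact: cf.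
  exact: (@sqrt_pos_exp_continuous _ (f x)).
case: j rj => [|[|[|j]]]; rewrite ?doubleS // !ltnS => rj.
apply: (@CrSI _ _ _ _ (fun i x => (j.+3%:R / 2 * s (f x) ^+ j.+1) *
                                  'D_(delta_mx 0 i) f x)).
- move=> x; apply: (@continuous_comp _ _ _ f (fun t => s t ^+ j.+3)); first exact: cf.
  exact: (@sqrt_pos_exp_continuous _ (f x)).
- move=> i x; apply: (is_derive_comp_real (is_derive_sqrt_pos_exp (f x) j)).
  exact: Cr_is_derive Cf.
- move=> i; apply: Cr_mul; last exact: Cr_derive.
  by apply: Cr_mul; [exact: Cr_cst|apply: IH => //; exact: Cr_pred].
Qed.

Lemma Cr_sqrt_pos n r (f : 'rV[R]_n -> R) :
  (forall x, 0 < f x) -> Cr r f -> Cr r (fun x => s (f x)).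
Proof.
move=> f0; elim: r => [|r IH] Cf; have cf := Cr_continuous Cf.
  move=> x; apply: (@continuous_comp _ _ _ f s); first exact: cf.
  exact: sqrt_pos_continuous.
apply: (@CrSI _ _ _ _ (fun i x => (2 * s (f x))^-1 * 'D_(delta_mx 0 i) f x)).
- move=> x; apply: (@continuous_comp _ _ _ f s); first exact: cf.
  exact: sqrt_pos_continuous.
- move=> i x; have fx0 : f x != 0 by rewrite gt_eqF.
  apply: (is_derive_comp_real (is_derive_sqrt_pos fx0)).
  exact: Cr_is_derive Cf.
- move=> i; apply: Cr_mul; last exact: Cr_derive.
  apply: Cr_inv => [x|].
    by rewrite mulf_neq0 ?gt_eqF // sqrt_pos_gt0.
  by apply: Cr_mul; [exact: Cr_cst|apply: IH; exact: Cr_pred].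
Qed.

End Sqrt.

(** * Closure properties of D^r functions, and the function [H] encoding the constraints *)

Section DefinableCr.
Context (R : realFieldType) (S : forall n, set (set 'rV[R]_n)).
Hypothesis HS : is_expansion S.

Lemma Dr_cst n r (a : R) : Dr S r (fun _ : 'rV[R]_n => a).
Proof. by split; [exact: definable_cst|exact: Cr_cst]. Qed.

Lemma Dr_add n r (f g : 'rV[R]_n -> R) :
  Dr S r f -> Dr S r g -> Dr S r (fun x => f x + g x).
Proof. by move=> [? ?] [? ?]; split; [exact: definable_add|exact: Cr_add]. Qed.

Lemma Dr_mul n r (f g : 'rV[R]_n -> R) :
  Dr S r f -> Dr S r g -> Dr S r (fun x => f x * g x).
Proof. by move=> [? ?] [? ?]; split; [exact: definable_mul|exact: Cr_mul]. Qed.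

Lemma Dr_opp n r (f : 'rV[R]_n -> R) : Dr S r f -> Dr S r (fun x => - f x).
Proof.
move=> Df; rewrite (_ : (fun x => _) = fun x => -1 * f x).
  exact: Dr_mul (Dr_cst _ _ _) Df.
by apply/funext => x; rewrite mulN1r.
Qed.

Lemma Dr_exp n r (f : 'rV[R]_n -> R) j : Dr S r f -> Dr S r (fun x => f x ^+ j).
Proof.
move=> Df; elim: j => [|j IH]; first exact: Dr_cst.
rewrite (_ : (fun x => _) = fun x => f x * f x ^+ j); first exact: Dr_mul.
by apply/funext => x; rewrite exprS.
Qed.

Lemma Dr_sum n r k (f : 'I_k -> 'rV[R]_n -> R) :
  (forall i, Dr S r (f i)) -> Dr S r (fun x => \sum_(i < k) f i x).
Proof.
move=> Df; elim: k f Df => [|k IH] f Df.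
  rewrite (_ : (fun x => _) = fun=> 0); first exact: Dr_cst.
  by apply/funext => x; rewrite big_ord0.
rewrite (_ : (fun x => _) =
  fun x => f ord0 x + \sum_(i < k) f (lift ord0 i) x).
  by apply: Dr_add => //; apply: (IH (fun i => f (lift ord0 i))).
by apply/funext => x; rewrite big_ord_recl.
Qed.

Lemma Dr_inv n r (f : 'rV[R]_n -> R) :
  (forall x, f x != 0) -> Dr S r f -> Dr S r (fun x => (f x)^-1).
Proof. by move=> ? [? ?]; split; [exact: definable_inv|exact: Cr_inv]. Qed.

Variable s : R -> R.
Hypothesis hs : is_sqrt_pos s.

Lemma Dr_sqrt_pos n r (f : 'rV[R]_n -> R) :
  (forall x, 0 < f x) -> Dr S r f -> Dr S r (fun x => s (f x)).
Proof. by move=> ? [? ?]; split; [exact: definable_sqrt|exact: Cr_sqrt_pos]. Qed.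

Lemma Dr_sqrt_pos_exp n r j (f : 'rV[R]_n -> R) :
  (r.*2 < j)%N -> Dr S r f -> Dr S r (fun x => s (f x) ^+ j).
Proof.
move=> rj [Sf Cf]; split; last exact: Cr_sqrt_pos_exp.
have Ss := definable_sqrt HS hs Sf.
elim: j {rj} => [|j IH]; first exact: definable_cst.
rewrite (_ : (fun x => _) = fun x => s (f x) * s (f x) ^+ j).
  exact: definable_mul.
by apply/funext => x; rewrite exprS.
Qed.

(** Positive and negative parts, one of which vanishes: sign cases become polynomial identities in
    the two roots. *)
Lemma sqrt_pos_decomp t :
  t = s t ^+ 2 - s (- t) ^+ 2 /\ (s t = 0 \/ s (- t) = 0).
Proof.
have [t0|/ltW t0] := leP t 0.
  rewrite (sqrt_pos_neg hs t0) (sqrt_pos_sqr hs) ?oppr_ge0 //.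
  by split; [ring|left].
rewrite (sqrt_pos_sqr hs t0) (sqrt_pos_neg hs) ?oppr_le0 //.
by split; [ring|right].
Qed.

Lemma exists_cone_function n r k (f : 'I_k -> 'rV[R]_n -> R) :
  (forall i, Dr S r (f i)) ->
  exists (H : 'rV[R]_n -> R) (u : 'I_k -> 'rV[R]_n -> R),
    [/\ Dr S r H, forall i, Dr S r (u i),
        forall x, 0 <= H x, forall x, H x = 0 -> forall i, 0 <= f i x &
        forall x, \sum_(i < k) u i x ^+ 2 * f i x = - H x].
Proof.
move=> Df; set N := r.*2.+1; pose u i x := s (- f i x) ^+ N.
(* This is [- u_i^2 f_i]: the square gives [N * 2], and [- f i x] equals [s (- f i x) ^+ 2] wherever
   [u i x] is nonzero. *)
pose v i x := s (- f i x) ^+ (N * 2 + 2).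
have v0 i x : 0 <= v i x by rewrite exprn_ge0 //; case: (hs (- f i x)).
exists (fun x => \sum_(i < k) v i x), u; split.
- apply: Dr_sum => i; apply: Dr_sqrt_pos_exp; last exact: Dr_opp.
  by rewrite /N; lia.
- by move=> i; apply: Dr_sqrt_pos_exp; last exact: Dr_opp.
- by move=> x; apply: sumr_ge0.
(* A vanishing sum of nonnegative terms forces every [s (- f i x)] to be [0], which leaves [f i x]
   equal to a square. *)
- move=> x /eqP; rewrite psumr_eq0 // => /allP /= h i.
  have := h i (mem_index_enum _); rewrite /v expf_eq0 addn_gt0 orbT /= => /eqP s0.
  by have [-> _] := sqrt_pos_decomp (f i x); rewrite s0 expr0n subr0 sqr_ge0.
- move=> x; rewrite -sumrN; apply: eq_bigr => i _; rewrite /u /v.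
  have [] := sqrt_pos_decomp (f i x).
  move: (f i x) (s (f i x)) (s (- f i x)) => _ a b -> [->|->].
    by rewrite exprD exprM expr0n /=; ring.
  by rewrite !expr0n addn2 /= !mul0r oppr0.
Qed.

End DefinableCr.

End Preliminaries.

(** * Both representations, derived from the single function [H] *)

Theorem theorem3p14 (R : realFieldType) (S : forall n, set (set 'rV[R]_n))
  (HS : is_expansion S) (Hloc : locally_o_minimal S)
  (Hdc : definably_complete S)
  (r n k : nat) (f : 'I_k -> 'rV[R]_n -> R) (g : 'rV[R]_n -> R)
  (Hf : forall i, Dr S r (f i)) (Hg : Dr S r g)
  (HSne : exists x : 'rV[R]_n, forall i, 0 <= f i x) :
  ((forall x, (forall i, 0 <= f i x) -> 0 <= g x) ->
     exists (p v0 : 'rV[R]_n -> R) (v : 'I_k -> 'rV[R]_n -> R),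
       [/\ Dr S r p, Dr S r v0, (forall i, Dr S r (v i)),
           (forall x, p x = 0 -> g x = 0) &
           (forall x, p x ^+ 2 * g x
                      = v0 x ^+ 2 + \sum_(i < k) v i x ^+ 2 * f i x)]) /\
  ((forall x, (forall i, 0 <= f i x) -> 0 < g x) ->
     exists (v0 : 'rV[R]_n -> R) (v : 'I_k -> 'rV[R]_n -> R),
       [/\ Dr S r v0, (forall i, Dr S r (v i)) &
           (forall x, g x = v0 x ^+ 2 + \sum_(i < k) v i x ^+ 2 * f i x)]).
Proof.
have [s hs] := exists_sqrt_pos HS Hdc.
have [H [u [DH Du H0 HS0 uE]]] := exists_cone_function HS hs Hf.
(* A common factor [w] on all [u i] gives the weighted sum [- w^2 H], so one function [w] determines
   all the [v i]. *)
have vE w x : \sum_(i < k) (w x * u i x) ^+ 2 * f i x = - (w x ^+ 2 * H x).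
  rewrite -mulrN -uE mulr_sumr; apply: eq_bigr => i _.
  by ring.
set N := r.*2.+1.
(* Exponents are written [N + j], even for [j = 0], so that this one fact applies to all of them by
   unification. *)
have DsN h j : Dr S r h -> Dr S r (fun x => s (h x) ^+ (N + j)).
  by move=> Dh; apply: Dr_sqrt_pos_exp => //; rewrite /N; lia.
split=> g0.
  pose p x := s (g x) ^+ (N + 0) + s (- g x) ^+ (N + 0) * s (H x) ^+ (N + 1).
  pose w x := s (- g x) ^+ (N + 1) * s (H x) ^+ (N + 0).
  have DNg := Dr_opp HS Hg.
  exists p, (fun x => s (g x) ^+ (N + 1)), (fun i x => w x * u i x); split.
  - by apply: Dr_add; [|exact: DsN|apply: Dr_mul; [|exact: DsN|exact: DsN]].
  - exact: DsN.
  - move=> i; apply: (Dr_mul HS _ (Du i)).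
    by apply: Dr_mul; [|exact: DsN|exact: DsN].
  (* If [g x > 0], the first summand of [p] is nonzero. If [g x < 0], the point violates a
     constraint, so [H x > 0] and the second summand is nonzero. *)
  - move=> x px; have [gx|gx|//] := ltgtP (g x) 0; exfalso; last first.
      move: px; rewrite /p (sqrt_pos_neg hs (t := - g x)) ?oppr_le0 ?(ltW gx) //.
      rewrite [0 ^+ _]expr0n mul0r addr0; apply/eqP.
      by rewrite expf_neq0 // gt_eqF // sqrt_pos_gt0.
    have Hx : 0 < H x.
      rewrite lt_neqAle H0 andbT eq_sym; apply/eqP => /HS0 /g0.
      by rewrite leNgt gx.
    move: px; rewrite /p (sqrt_pos_neg hs (ltW gx)) [0 ^+ _]expr0n add0r.
    by apply/eqP; rewrite mulf_neq0 // expf_neq0 // gt_eqF // sqrt_pos_gt0 ?oppr_gt0.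
  - move=> x; rewrite vE /p /w.
    have [] := sqrt_pos_decomp hs (g x); have := sqrt_pos_sqr hs (H0 x).
    (* Substituting [H = c^2] and [g = a^2 - b^2] leaves an identity in [a], [b], [c], checked for
       [a = 0] and for [b = 0]. *)
    move: (H x) (g x) (s (H x)) (s (g x)) (s (- g x)) => _ _ c a b <- -> h.
    by case: h => ->; rewrite !exprD !expr1 !expr0 !expr0n /=; ring.
pose B x := H x + s (g x) ^+ (N + 0).
have B0 x : 0 < B x.
  have sg := exprn_ge0 (N + 0) (proj1 (hs (g x))).
  have [gx|gx] := leP (g x) 0; last first.
    by rewrite ltr_wpDl // exprn_gt0 // sqrt_pos_gt0.
  rewrite ltr_wpDr // lt_neqAle H0 andbT eq_sym; apply/eqP => /HS0 /g0.
  by rewrite ltNge gx.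
(* The numerators make [w^2 H] exceed [-g] where [g <= 0]: there [B = H], [(1 + H^2)^2 / H >= 1] and
   [(1 + g^2)^2 > -g]. *)
pose w x := (1 + g x ^+ 2) * (1 + H x ^+ 2) * (B x)^-1.
have Dw : Dr S r w.
  have D1 h : Dr S r h -> Dr S r (fun x => 1 + h x ^+ 2).
    by move=> Dh; apply: Dr_add => //; [exact: Dr_cst|exact: Dr_exp].
  apply: Dr_mul => //; first by apply: Dr_mul => //; exact: D1.
  apply: Dr_inv => // [x|]; first by rewrite gt_eqF.
  by apply: Dr_add => //; exact: DsN.
pose e x := g x + w x ^+ 2 * H x.
have e0 x : 0 < e x.
  rewrite /e; have [gx|gx] := leP (g x) 0; last first.
    by rewrite ltr_wpDr // mulr_ge0 // sqr_ge0.
  have BH : B x = H x by rewrite /B (sqrt_pos_neg hs gx) expr0n addr0.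
  have Hx : 0 < H x by rewrite -BH.
  have -> : w x ^+ 2 * H x = (1 + g x ^+ 2) ^+ 2 * ((1 + H x ^+ 2) ^+ 2 / H x).
    by rewrite /w BH; field; rewrite gt_eqF.
  have : 1 <= (1 + H x ^+ 2) ^+ 2 / H x by rewrite ler_pdivlMr //; nra.
  move: (_ / _) (g x) gx => q a a0 q1.
  have aX : - a < (1 + a ^+ 2) ^+ 2 by nra.
  move: (_ ^+ 2) aX => X aX; have X0 : 0 < X by lra.
  by nra.
exists (fun x => s (e x)), (fun i x => w x * u i x); split.
- apply: Dr_sqrt_pos => //; apply: Dr_add => //; apply: Dr_mul => //.
  exact: Dr_exp.
- by move=> i; apply: Dr_mul.
- by move=> x; rewrite vE (sqrt_pos_sqr hs) ?ltW // /e addrK.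
Qed.
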